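(* Let $h>0$ and $\mathbb{T}=h\mathbb{Z}$. If a given difference equation $$H(t,y(t+h),\Delta_hy(t))+\sum_{k=\frac{t_0}{h}}^{\frac{t}{h}-1}h\,G\big(kh,y(kh+h),\Delta_hy(kh)\big)=\mathrm{const}$$ is the Euler--Lagrange equation of a discrete variational problem $$\mathcal{I}(y)=\sum_{k=\frac{t_0}{h}}^{\frac{t_1}{h}-1}h\,L\big(kh,y(kh+h),\Delta_hy(kh)\big),$$ then its equation of variation $$\partial_2H[u]_h(t)\,u(t+h)+\partial_3H[u]_h(t)\,\Delta_hu(t)+h\sum_{k=\frac{t_0}{h}}^{\frac{t}{h}-1}\Big(\partial_2G[u]_h(kh)\,u(kh+h)+\partial_3G[u]_h(kh)\,\Delta_hu(kh)\Big)=0$$ is self-adjoint, in the sense that it has the form $$p(t)\Delta_hu(t)+\sum_{k=\frac{t_0}{h}}^{\frac{t}{h}-1}h\,q(kh)\,u(kh+h)=\mathrm{const}$$ with functions $p,q:h\mathbb{Z}\to\mathbb{R}$ and $p(t)\neq0$ for all $t\in h\mathbb{Z}$.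
   Context: Here $t,t_0,t_1\in h\mathbb{Z}$, $\Delta_hy(t)=\frac{y(t+h)-y(t)}{h}$, and $[y]_h(t)=(t,y(t+h),\Delta_hy(t))$, so $F[y]_h(t)=F(t,y(t+h),\Delta_hy(t))$. $\partial_i$ is the partial derivative with respect to the $i$-th argument. ''const'' means some real constant independent of $t$. Sums $\sum_{k=a/h}^{b/h-1}$ are delta integrals from $a$ to $b$ on $h\mathbb{Z}$: they are $0$ if $a=b$ and equal $-\sum_{k=b/h}^{a/h-1}$ if $a>b$. (On $h\mathbb{Z}$ every function is rd-continuous.) Standing assumption (part of the definition of the equation of variation): the partial derivatives $\partial_2F,\partial_3F$ exist along every curve for $F\in\{G,H\}$, and $\partial_3H\neq0$. In the equation of variation, the coefficients $\partial_iH[u]_h$, $\partial_iG[u]_h$ are regarded as functions of $t$ along the curve $u$. Being the Euler--Lagrange equation of $\mathcal{I}$, with $L\in C^2$, means that the given equation is the summed-form Euler--Lagrange equation $\partial_3L[y]_h(t)-\sum_{k=t_0/h}^{t/h-1}h\,\partial_2L[y]_h(kh)=\mathrm{const}$, i.e. $H=\partial_3L$ and $G=-\partial_2L$.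
   Formalization: The added hypothesis is that ∂₃H[u]_h(t)+h∂₂H[u]_h(t)≠0 for all t in hZ along the curve u; without it the claim fails, e.g. h=1, L=v²/2−xv (H=v−x, G=v), where p must vanish. *)

(* Defs.v *)
From Stdlib Require Import Reals ZArith List.
From Coquelicot Require Import Coquelicot.
Open Scope R_scope.

(* A function on hZ is represented by a function on R, of which only the values
   at the points [pt h n] (n : Z) are ever used; likewise for the first argument
   of H, G and L. The points t, t0, t1 of hZ are given by their indices
   n = t/h, n0 = t0/h, n1 = t1/h. *)
Definition pt (h : R) (n : Z) : R := IZR n * h.

Definition fwd_diff (h : R) (y : R -> R) (t : R) : R := (y (t + h) - y t) / h.

(* F[y]_h(t); the codomain is a parameter so that it also applies to predicates
   such as the existence of a partial derivative. *)
Definition along {A : Type} (h : R) (F : R -> R -> R -> A) (y : R -> R) (t : R) : A :=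
  F t (y (t + h)) (fwd_diff h y t).

Definition partial2 (F : R -> R -> R -> R) (t x v : R) : R := Derive (fun z => F t z v) x.
Definition partial3 (F : R -> R -> R -> R) (t x v : R) : R := Derive (fun z => F t x z) v.
Definition ex_partial2 (F : R -> R -> R -> R) (t x v : R) : Prop :=
  ex_derive (fun z => F t z v) x.
Definition ex_partial3 (F : R -> R -> R -> R) (t x v : R) : Prop :=
  ex_derive (fun z => F t x z) v.

(* f a + f (a+1) + ... + f (b-1), and 0 if b <= a. *)
Definition range_sum (a b : Z) (f : Z -> R) : R :=
  fold_right Rplus 0
    (map (fun i => f (a + Z.of_nat i)%Z) (seq 0 (Z.to_nat (b - a)))).

(* The sum over k = a, ..., b-1, with the orientation of an integral. *)
Definition dsum (a b : Z) (f : Z -> R) : R :=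
  if (a <=? b)%Z then range_sum a b f else - range_sum b a f.

(* L(t, ., .) is of class C^2 on the plane, for every t in hZ (the first
   argument is discrete): [ex_diff_n] asks for all partial derivatives up to the
   given order to exist and be continuous in both variables jointly. *)
Definition C2_on_hZ (h : R) (L : R -> R -> R -> R) : Prop :=
  forall (n : Z) (x v : R), ex_diff_n (L (pt h n)) 2 x v.

(* The equation H[y](t) + sum h G[y] = const is the Euler-Lagrange equation of
   the variational problem for the functional J. *)
Definition is_Euler_Lagrange_equation_of (h : R) (n0 n1 : Z) (J : (R -> R) -> R)
    (H G : R -> R -> R -> R) : Prop :=
  exists L : R -> R -> R -> R,
    C2_on_hZ h L /\
    (forall y : R -> R, J y = dsum n0 n1 (fun k => h * along h L y (pt h k))) /\
    (forall (n : Z) (x v : R), H (pt h n) x v = partial3 L (pt h n) x v) /\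
    (forall (n : Z) (x v : R), G (pt h n) x v = - partial2 L (pt h n) x v).

Definition variation_assumption (h : R) (H G : R -> R -> R -> R) : Prop :=
  forall (y : R -> R) (n : Z),
    along h (ex_partial2 H) y (pt h n) /\ along h (ex_partial3 H) y (pt h n) /\
    along h (ex_partial2 G) y (pt h n) /\ along h (ex_partial3 G) y (pt h n) /\
    along h (partial3 H) y (pt h n) <> 0.

(* The equation of variation along u is genuinely of first order: since
   w(t+h) = w(t) + h Delta_h w(t), the coefficient of Delta_h w(t), once w(t+h)
   is eliminated, is partial3 H + h * partial2 H. It has to be nonzero for the
   equation to have a self-adjoint form, and this does not follow from
   partial3 H <> 0: for h = 1, L = v^2/2 - x v, H = v - x, G = v it vanishes
   identically and the equation of variation reduces to w(t0) = 0. *)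
Definition variation_first_order (h : R) (H : R -> R -> R -> R) (u : R -> R) : Prop :=
  forall n : Z,
    along h (partial3 H) u (pt h n) + h * along h (partial2 H) u (pt h n) <> 0.

(* Left-hand side at t = nh of the equation of variation, as a linear expression
   in the unknown w, with coefficients taken along the curve u. *)
Definition variation_lhs (h : R) (n0 : Z) (H G : R -> R -> R -> R) (u w : R -> R)
    (n : Z) : R :=
  along h (partial2 H) u (pt h n) * w (pt h n + h)
  + along h (partial3 H) u (pt h n) * fwd_diff h w (pt h n)
  + h * dsum n0 n (fun k =>
          along h (partial2 G) u (pt h k) * w (pt h k + h)
          + along h (partial3 G) u (pt h k) * fwd_diff h w (pt h k)).

Definition self_adjoint_lhs (h : R) (n0 : Z) (p q w : R -> R) (n : Z) : R :=
  p (pt h n) * fwd_diff h w (pt h n)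
  + dsum n0 n (fun k => h * q (pt h k) * w (pt h k + h)).

(* The equation E w = 0 on hZ has the form self_adjoint_lhs p q w = const: p and
   q do not depend on the unknown w, and c does not depend on t. *)
Definition is_self_adjoint (h : R) (n0 : Z) (E : (R -> R) -> Z -> R) : Prop :=
  exists p q : R -> R,
    (forall n : Z, p (pt h n) <> 0) /\
    (forall w : R -> R, exists c : R, forall n : Z,
        E w n = self_adjoint_lhs h n0 p q w n - c).

(* Main.v *)
Require Import Defs.
From Stdlib Require Import Reals ZArith List Lia Lra.
From Coquelicot Require Import Coquelicot.
Open Scope R_scope.

(** For H = L_v and G = - L_x the equation of variation has coefficients
    a = L_vx in front of w(t+h) and, by Schwarz's theorem, - L_xv = - a in front
    of Delta w under the sum. Writing a(t) w(t+h) = a(t) w(t) + h a(t) Delta w(t)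
    and summing a Delta w by parts turns the left-hand side into
    (L_vv + h a) Delta w + sum (h (Delta a - L_xx) w(t+h)) + a(t0) w(t0), so that
    p = L_vv + h a and q = Delta a - L_xx. *)

Lemma range_sum_diag (a : Z) (f : Z -> R) : range_sum a a f = 0.
Proof. unfold range_sum; now rewrite Z.sub_diag. Qed.

Lemma range_sum_succ_r (a b : Z) (f : Z -> R) :
  (a <= b)%Z -> range_sum a (Z.succ b) f = range_sum a b f + f b.
Proof.
  intros Hab; unfold range_sum.
  replace (Z.to_nat (Z.succ b - a)) with (S (Z.to_nat (b - a))) by lia.
  rewrite seq_S, map_app, fold_right_app; simpl.
  replace (a + Z.of_nat (Z.to_nat (b - a)))%Z with b by lia.
  generalize (map (fun i => f (a + Z.of_nat i)%Z) (seq 0 (Z.to_nat (b - a)))).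
  intros l; induction l as [|x l IH]; simpl; lra.
Qed.

Lemma range_sum_succ_l (a b : Z) (f : Z -> R) :
  (a < b)%Z -> range_sum a b f = f a + range_sum (Z.succ a) b f.
Proof.
  intros Hab; unfold range_sum.
  replace (Z.to_nat (b - a)) with (S (Z.to_nat (b - Z.succ a))) by lia.
  simpl; rewrite Z.add_0_r, <- seq_shift, map_map.
  do 2 f_equal; apply map_ext; intros i; f_equal; lia.
Qed.

Lemma dsum_diag (a : Z) (f : Z -> R) : dsum a a f = 0.
Proof. unfold dsum; rewrite Z.leb_refl; apply range_sum_diag. Qed.

(** The orientation of [dsum] makes this hold for [n < a] too: there the new term cancels the first
    term of the negated sum. *)
Lemma dsum_succ (a n : Z) (f : Z -> R) :
  dsum a (Z.succ n) f = dsum a n f + f n.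
Proof.
  unfold dsum.
  destruct (Z.leb_spec a (Z.succ n)), (Z.leb_spec a n); try lia.
  - now apply range_sum_succ_r.
  - replace a with (Z.succ n) by lia.
    rewrite (range_sum_succ_l n), !range_sum_diag by lia; lra.
  - rewrite (range_sum_succ_l n) by lia; lra.
Qed.

Lemma pt_succ (h : R) (n : Z) : pt h (Z.succ n) = pt h n + h.
Proof. unfold pt; rewrite succ_IZR; ring. Qed.

Lemma C2_Schwarz (f : R -> R -> R) (x v : R) :
  (forall x v, ex_diff_n f 2 x v) ->
  Derive (fun z => Derive (fun s => f z s) v) x =
  Derive (fun s => Derive (fun z => f z s) x) v.
Proof.
  intros Hf; apply Schwarz.
  - apply locally_2d_forall; intros x' v'.
    destruct (Hf x' v') as (_ & E1 & E2 & (_ & _ & E3 & _) & (_ & E4 & _)).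
    now repeat split.
  - now destruct (Hf x v) as (_ & _ & _ & _ & (_ & _ & _ & (C & _) & _)).
  - now destruct (Hf x v) as (_ & _ & _ & (_ & _ & _ & _ & (C & _)) & _).
Qed.

(** Up to sign, both sides are mixed second partials of L, taken in opposite orders. *)
Lemma Euler_Lagrange_partials (h : R) (n0 n1 : Z) (J : (R -> R) -> R)
    (H G : R -> R -> R -> R) (n : Z) (x v : R) :
  is_Euler_Lagrange_equation_of h n0 n1 J H G ->
  partial3 G (pt h n) x v = - partial2 H (pt h n) x v.
Proof.
  intros (L & HL & _ & HH & HG); unfold partial2, partial3.
  rewrite (Derive_ext _ _ _ (fun z => HG n x z)), Derive_opp.
  rewrite (Derive_ext _ _ _ (fun z => HH n z v)).
  f_equal; symmetry; exact (C2_Schwarz (L (pt h n)) x v (HL n)).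
Qed.

Theorem corollary3p10 (h : R) (h_pos : 0 < h) (n0 n1 : Z)
    (H G : R -> R -> R -> R) (J : (R -> R) -> R)
    (Hvar : variation_assumption h H G)
    (HEL : is_Euler_Lagrange_equation_of h n0 n1 J H G)
    (u : R -> R)
    (Hfirst_order : variation_first_order h H u) :
  is_self_adjoint h n0 (variation_lhs h n0 H G u).
Proof.
  set (a := along h (partial2 H) u).
  exists (fun t => along h (partial3 H) u t + h * a t).
  exists (fun t => along h (partial2 G) u t + fwd_diff h a t).
  split; [exact Hfirst_order|].
  (* Minus the boundary term at t0 left by the summation by parts. *)
  intros w; exists (- (a (pt h n0) * w (pt h n0))).
  assert (HG : forall k, along h (partial3 G) u (pt h k) = - a (pt h k)).
  { intros k; exact (Euler_Lagrange_partials _ _ _ _ _ _ k _ _ HEL). }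
  assert (Hparts : forall n,
    h * dsum n0 n (fun k =>
          along h (partial2 G) u (pt h k) * w (pt h k + h)
          + along h (partial3 G) u (pt h k) * fwd_diff h w (pt h k))
    = dsum n0 n (fun k =>
          h * (along h (partial2 G) u (pt h k) + fwd_diff h a (pt h k)) * w (pt h k + h))
      - a (pt h n) * w (pt h n) + a (pt h n0) * w (pt h n0)).
  (* Points on both sides of t0 are needed, so the induction step is an equivalence between [n] and
     [Z.succ n]. *)
  { apply (Z.central_induction _ _ n0).
    - rewrite !dsum_diag; ring.
    - intros n; rewrite !dsum_succ, HG, pt_succ, Rmult_plus_distr_l.
      (* Both sides grow by the same amount, by the product rule for Delta (a w); this gives both
         implications. *)
      match goal with |- _ = ?r <-> _ + ?x = ?s =>
        assert (Hstep : r + x = s) by (unfold fwd_diff; field; lra)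
      end.
      lra. }
  intros n; unfold variation_lhs, self_adjoint_lhs.
  (* What remains, a(t) w(t+h) - a(t) w(t) = h a(t) Delta w(t), is the second summand of p times
     Delta w. *)
  fold a; rewrite Hparts; unfold fwd_diff; field; lra.
Qed.
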